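(* A smooth connected manifold $\mathcal{M}$ is compact if and only if the space $(\mathrm{Met}(\mathcal{M}),\mathbb{d}^{\mathcal{M}})$ of rough Riemannian metrics on $\mathcal{M}$ is connected.
   Context: $\mathcal{M}$ carries a smooth differentiable structure and has no boundary. A set $Z\subset\mathcal{M}$ has measure zero if its image in every smooth chart has Lebesgue measure zero; ''almost every'' (a.e.) refers to this notion. A rough Riemannian metric on $\mathcal{M}$ is a measurable symmetric $(2,0)$-tensor field $\mathrm{g}$ (a measurable section of symmetric bilinear forms on $T\mathcal{M}$; fields agreeing a.e. are identified) such that for every $x\in\mathcal{M}$ there is a chart $(U,\psi)$ near $x$ and a constant $C_U\ge 1$ with $C_U^{-1}|u|_{\psi^*\delta(y)}\le |u|_{\mathrm{g}(y)}\le C_U|u|_{\psi^*\delta(y)}$ for almost every $y\in U$ and all $u\in T_yU$. Here $|u|_{\mathrm{g}(y)}=\sqrt{\mathrm{g}(y)[u,u]}$ and $\delta$ is the Euclidean metric. $\mathrm{Met}(\mathcal{M})$ is the set of all rough Riemannian metrics on $\mathcal{M}$. For $C\ge1$, write $\mathrm{g}\sim_C\mathrm{h}$ if $C^{-1}|u|_{\mathrm{h}(x)}\le|u|_{\mathrm{g}(x)}\le C|u|_{\mathrm{h}(x)}$ for almost every $x\in\mathcal{M}$ and all $u\in T_x\mathcal{M}$. The extended metric $\mathbb{d}^{\mathcal{M}}$ on $\mathrm{Met}(\mathcal{M})$ is $\mathbb{d}^{\mathcal{M}}(\mathrm{g},\mathrm{h})=\inf\{\log C: C\ge 1,\ \mathrm{g}\sim_C\mathrm{h}\}$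 if some such $C$ exists, and $+\infty$ otherwise. $\mathrm{Met}(\mathcal{M})$ is given the topology induced by $\mathbb{d}^{\mathcal{M}}$ (generated by balls of finite radius). *)

(* Defs.v *)
From HB Require Import structures.
From mathcomp Require Import all_boot all_order all_algebra.
From mathcomp Require Import sesquilinear.
From mathcomp Require Import all_classical all_reals all_analysis.
Import Order.TTheory GRing.Theory Num.Theory.
Import numFieldNormedType.Exports.

Set Implicit Arguments.
Unset Strict Implicit.
Unset Printing Implicit Defensive.

Local Open Scope classical_set_scope.
Local Open Scope ring_scope.

Section Euclidean.
Variables (R : realType) (n : nat).

Definition enorm (v : 'rV[R]_n) : R := Num.sqrt (\sum_i v 0 i ^+ 2).

(* A pair (a, b) stands for the closed box of all x with a_i <= x_i <= b_i. *)
Definition box (p : 'rV[R]_n * 'rV[R]_n) : set 'rV[R]_n :=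
  [set x | forall i, p.1 0 i <= x 0 i <= p.2 0 i].

Definition box_volume (p : 'rV[R]_n * 'rV[R]_n) : R :=
  \prod_i Num.max 0 (p.2 0 i - p.1 0 i).

(* The covering families may be finite or empty: for n = 0 every box has
   volume 1, so that set0 is the only null set. *)
Definition lebesgue_null (A : set 'rV[R]_n) : Prop :=
  forall e : R, 0 < e ->
    exists S : set ('rV[R]_n * 'rV[R]_n),
      [/\ countable S, A `<=` \bigcup_(p in S) box p &
          (\esum_(p in S) (box_volume p)%:E <= e%:E)%E].

(* The Lebesgue sigma-algebra as the completion of the Borel sigma-algebra:
   it is generated by the open sets and the null sets. *)
Definition lebesgue_space : Type :=
  g_sigma_algebraType
    ([set A | open A \/ lebesgue_null A] : set (set 'rV[R]_n)).

HB.instance Definition _ := Measurable.on lebesgue_space.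

Lemma lebesgue_nullS (A B : set 'rV[R]_n) :
  A `<=` B -> lebesgue_null B -> lebesgue_null A.
Proof.
move=> AB nB e e0; have [S [cS BS Se]] := nB e e0.
by exists S; split=> //; exact: subset_trans BS.
Qed.

Lemma lebesgue_null0 : lebesgue_null set0.
Proof.
move=> e e0; exists set0; split=> //; last by rewrite esum_set0 lee_fin ltW.
Qed.

Lemma lebesgue_nullU (A B : set 'rV[R]_n) :
  lebesgue_null A -> lebesgue_null B -> lebesgue_null (A `|` B).
Proof.
move=> nA nB e e0; have e20 : 0 < e / 2 by rewrite divr_gt0.
have [S [cS AS Se]] := nA _ e20; have [T [cT BT Te]] := nB _ e20.
have vol0 p : (0 <= (box_volume p)%:E)%E.
  by rewrite lee_fin; apply: prodr_ge0 => i _; rewrite le_max lexx.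
exists (S `|` T); split.
- rewrite -bigcup2E; apply: bigcup_countable => // -[|[|k]] _ //=.
- by move=> x [/AS|/BT] [p Sp px]; exists p => //; [left|right].
rewrite (esumID S) // [e]splitr EFinD leeD //.
  by rewrite setIidr // => p; left.
rewrite -setDE setDUl setDv set0U.
apply: le_trans Te; rewrite (esumID S T) //= -setDE leeDr //.
exact: esum_ge0.
Qed.

End Euclidean.

(* f is of class C^k on the open set U *)
Fixpoint Ck (R : realType) (m n k : nat) (U : set 'rV[R]_m)
    (f : 'rV[R]_m -> 'rV[R]_n) : Prop :=
  match k with
  | 0 => forall x, U x -> {for x, continuous f}
  | k'.+1 => (forall x, U x -> differentiable f x) /\
             (forall v : 'rV[R]_m, Ck k' U ('D_v f))
  end.

Definition smooth_on (R : realType) (m n : nat) (U : set 'rV[R]_m)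
    (f : 'rV[R]_m -> 'rV[R]_n) : Prop := forall k, Ck k U f.

(* Only the values of the chart on its domain U, and of its inverse on the
   image of U, are meaningful. *)
Record chart (R : realType) (n : nat) (M : Type) := Chart {
  chart_dom : set M;
  chart_map :> M -> 'rV[R]_n;
  chart_inv : 'rV[R]_n -> M }.

Section Charts.
Variables (R : realType) (n : nat) (M : topologicalType).
Implicit Types c : chart R n M.

Definition chart_img c : set 'rV[R]_n := c @` chart_dom c.

Definition is_chart c : Prop :=
  [/\ open (chart_dom c), open (chart_img c),
      {within chart_dom c, continuous c},
      {within chart_img c, continuous (chart_inv c)} &
      forall x, chart_dom c x -> chart_inv c (c x) = x].

Definition transition c c' : 'rV[R]_n -> 'rV[R]_n := c' \o chart_inv c.

Definition smooth_transition c c' : Prop :=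
  smooth_on (c @` (chart_dom c `&` chart_dom c')) (transition c c').

End Charts.

Record smoothManifold (R : realType) (n : nat) := SmoothManifold {
  carrier :> topologicalType;
  manifold_hausdorff : hausdorff_space carrier;
  manifold_second_countable : @second_countable carrier;
  atlas : set (chart R n carrier);
  atlas_chart : forall c, atlas c -> is_chart c;
  atlas_cover : forall x, exists2 c, atlas c & chart_dom c x;
  atlas_smooth : forall c c', atlas c -> atlas c' -> smooth_transition c c';
  atlas_maximal : forall c, is_chart c ->
    (forall c', atlas c' -> smooth_transition c c' /\ smooth_transition c' c) ->
    atlas c }.

Section Tangent.
Variables (R : realType) (n : nat) (M : smoothManifold R n).
Implicit Types (x : M) (c : chart R n M).

Definition charts_at x : set (chart R n M) :=
  [set c | atlas c /\ chart_dom c x].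

(* A tangent vector at x is the family of its coordinate vectors in all the
   charts around x, related by the differentials of the transition maps; the
   value 0 at the other charts makes the representation unique.  MathComp's
   Jacobian 'J acts on row vectors from the right. *)
Definition tangent_family x : {pred chart R n M -> 'rV[R]_n} :=
  fun v => `[<
    (forall c c', charts_at x c -> charts_at x c' ->
      v c' = v c *m jacobian (transition c c') (c x)) /\
    (forall c, ~ charts_at x c -> v c = 0) >].

Lemma tangent_family_closed x : submod_closed (tangent_family x).
Proof.
split=> [|a u v /asboolP[uJ u0] /asboolP[vJ v0]]; apply/asboolP.
  by split=> [c c' _ _|c _]; rewrite ?mul0mx.
split=> [c c' xc xc'|c xc] /=.
  by rewrite !fctE (uJ c c') // (vJ c c') // mulmxDl -scalemxAl.
by rewrite !fctE u0 // v0 // scaler0 addr0.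
Qed.

HB.instance Definition _ x :=
  GRing.isSubmodClosed.Build R (chart R n M -> 'rV[R]_n) (tangent_family x)
    (tangent_family_closed x).

Record tangent x := Tangent {
  tangent_val : chart R n M -> 'rV[R]_n;
  tangentP : tangent_val \in tangent_family x }.

HB.instance Definition _ x := [isSub for @tangent_val x].
HB.instance Definition _ x := [Choice of tangent x by <:].
HB.instance Definition _ x := [SubChoice_isSubLmodule of tangent x by <:].

Definition tangent_coord x (c : chart R n M) (u : tangent x) : 'rV[R]_n :=
  tangent_val u c.

Definition measure_zero (Z : set M) : Prop :=
  forall c, atlas c -> lebesgue_null (c @` (Z `&` chart_dom c)).

Definition almost_every (A : set M) (P : M -> Prop) : Prop :=
  measure_zero [set x | A x /\ ~ P x].

Definition tensor_field := forall x, {biscalar (tangent x)}.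

(* In every chart c, the field is g_ij dx^i dx^j with measurable coefficients
   g_ij on the image of c. *)
Definition measurable_field (g : tensor_field) : Prop :=
  forall c, atlas c ->
    exists G : 'rV[R]_n -> 'M[R]_n,
      (forall i j, measurable_fun (chart_img c : set (lebesgue_space R n))
         ((fun y => G y i j) : lebesgue_space R n -> R)) /\
      (forall x (u v : tangent x), chart_dom c x ->
         g x u v = (tangent_coord c u *m G (c x) *m (tangent_coord c v)^T) 0 0).

Definition field_norm (g : tensor_field) x (u : tangent x) : R :=
  Num.sqrt (g x u u).

(* The norm of u for the pullback of the Euclidean metric by c. *)
Definition pullback_norm c x (u : tangent x) : R := enorm (tangent_coord c u).

Record roughMetric := RoughMetric {
  tensor :> tensor_field;
  tensor_sym : forall x (u v : tangent x), tensor x u v = tensor x v u;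
  tensor_measurable : measurable_field tensor;
  tensor_comparable : forall x, exists c (C : R),
    [/\ atlas c, chart_dom c x, 1 <= C &
        almost_every (chart_dom c) (fun y => forall u : tangent y,
          C^-1 * pullback_norm c u <= field_norm tensor u
            <= C * pullback_norm c u)] }.

HB.instance Definition _ := gen_eqMixin roughMetric.
HB.instance Definition _ := gen_choiceMixin roughMetric.

Implicit Types g h k : roughMetric.

Definition ae_equal g h : Prop :=
  almost_every setT (fun x => forall u v : tangent x, tensor g x u v = tensor h x u v).

Definition close_metrics (C : R) g h : Prop :=
  almost_every setT (fun x => forall u : tangent x,
    C^-1 * field_norm h u <= field_norm g u <= C * field_norm h u).

(* The infimum of the empty set is +oo in \bar R. *)
Definition rough_dist g h : \bar R :=
  ereal_inf [set (ln C)%:E | C in [set C : R | 1 <= C /\ close_metrics C g h]].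


Lemma almost_everyS (A : set M) (P Q : M -> Prop) :
  (forall x, P x -> Q x) -> almost_every A P -> almost_every A Q.
Proof.
move=> PQ aP c cM; apply: lebesgue_nullS (aP c cM).
by apply: image_subset => x [[Ax nQ] xc]; split=> //; split=> // /PQ.
Qed.

Lemma almost_everyT (A : set M) (P : M -> Prop) :
  (forall x, P x) -> almost_every A P.
Proof.
move=> Pt c cM; apply: lebesgue_nullS (@lebesgue_null0 _ _).
by move=> y [x [[_ nP] _] _]; case: (nP (Pt x)).
Qed.

Lemma almost_everyI (A : set M) (P Q : M -> Prop) :
  almost_every A P -> almost_every A Q ->
  almost_every A (fun x => P x /\ Q x).
Proof.
move=> aP aQ c cM; apply: lebesgue_nullS (lebesgue_nullU (aP c cM) (aQ c cM)).
move=> _ [x [[Ax nPQ] xc] <-].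
have [Px|nPx] := pselect (P x).
  by right; exists x => //; split=> //; split=> // Qx; exact: nPQ.
by left; exists x.
Qed.

Lemma ae_equal_refl : reflexive (fun g h => `[< ae_equal g h >]).
Proof. by move=> g; apply/asboolP; exact: almost_everyT. Qed.

Lemma ae_equalC g h : ae_equal g h -> ae_equal h g.
Proof. by apply: almost_everyS => x gh u v; rewrite gh. Qed.

Lemma ae_equal_sym : symmetric (fun g h => `[< ae_equal g h >]).
Proof. by move=> g h; apply/asboolP/asboolP; exact: ae_equalC. Qed.

Lemma ae_equal_trans : transitive (fun g h => `[< ae_equal g h >]).
Proof.
move=> h g k /asboolP gh /asboolP hk; apply/asboolP.
by apply: almost_everyS (almost_everyI gh hk) => x [e1 e2] u v; rewrite e1.
Qed.

Definition ae_equiv : equiv_rel roughMetric :=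
  EquivRel _ ae_equal_refl ae_equal_sym ae_equal_trans.

Lemma field_norm_ae g h : ae_equal g h ->
  almost_every setT (fun x =>
    forall u : tangent x, field_norm g u = field_norm h u).
Proof. by apply: almost_everyS => x gh u; rewrite /field_norm gh. Qed.

Lemma close_metrics_refl g : close_metrics 1 g g.
Proof. by apply: almost_everyT => x u; rewrite invr1 mul1r lexx. Qed.

Lemma close_metricsC C g h : 1 <= C ->
  close_metrics C g h -> close_metrics C h g.
Proof.
move=> C1; have C0 : 0 < C by exact: lt_le_trans C1.
apply: almost_everyS => x gh u; have /andP[lo hi] := gh u.
by rewrite ler_pdivrMl // hi /= -ler_pdivrMl.
Qed.

Lemma close_metrics_trans C D g h k : 1 <= C -> 1 <= D ->
  close_metrics C g h -> close_metrics D h k -> close_metrics (C * D) g k.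
Proof.
move=> C1 D1 gh hk; have C0 : 0 < C by exact: lt_le_trans C1.
apply: almost_everyS (almost_everyI gh hk) => x [ghx hkx] u.
have /andP[lo hi] := ghx u; have /andP[lo' hi'] := hkx u.
rewrite invfM -!mulrA; apply/andP; split.
  by apply: le_trans lo; rewrite ler_wpM2l // invr_ge0 ltW.
by apply: le_trans hi _; rewrite ler_wpM2l // ltW.
Qed.

Lemma rough_dist_refl g : rough_dist g g = 0%E.
Proof.
apply/eqP; rewrite eq_le; apply/andP; split.
  apply: ereal_inf_lbound; exists 1; last by rewrite ln1.
  by split=> //; exact: close_metrics_refl.
by apply: le_ereal_inf_tmp => _ [C [C1 _] <-]; rewrite lee_fin ln_ge0.
Qed.

Lemma rough_distC g h : rough_dist g h = rough_dist h g.
Proof.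
by congr ereal_inf; apply/seteqP; split=> _ [C [C1 gh] <-]; exists C => //;
  split=> //; exact: close_metricsC.
Qed.

Lemma rough_dist_triangle g h k (a b : R) :
  (rough_dist g h < a%:E -> rough_dist h k < b%:E ->
   rough_dist g k < (a + b)%:E)%E.
Proof.
move=> /ereal_inf_lt[_ [C [C1 gh] <-]]; rewrite lte_fin => Ca.
move=> /ereal_inf_lt[_ [D [D1 hk] <-]]; rewrite lte_fin => Db.
have C0 : 0 < C by exact: lt_le_trans C1.
have D0 : 0 < D by exact: lt_le_trans D1.
apply: (@le_lt_trans _ _ (ln (C * D))%:E); last first.
  by rewrite lte_fin lnM ?posrE // ltrD.
apply: ereal_inf_lbound; exists (C * D) => //; split.
  by rewrite -[1]mulr1 ler_pM.
exact: close_metrics_trans gh hk.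
Qed.

Lemma rough_dist_ae g g' h h' : ae_equal g g' -> ae_equal h h' ->
  rough_dist g h = rough_dist g' h'.
Proof.
move=> gg' hh'; congr ereal_inf; apply/seteqP.
by split=> _ [C [C1 gh] <-]; exists C => //; split=> //;
  apply: almost_everyS (almost_everyI gh (almost_everyI (field_norm_ae gg')
    (field_norm_ae hh'))) => x [ghx [eg eh]] u; move: (ghx u); rewrite eg eh.
Qed.

End Tangent.

Section Met.
Variables (R : realType) (n : nat) (M : smoothManifold R n).
Local Open Scope quotient_scope.

Definition Met : Type := {eq_quot (ae_equiv M)}.

HB.instance Definition _ := Choice.on Met.
HB.instance Definition _ := EqQuotient.on Met.

(* Independent of the choice of representatives, by met_dist_pi. *)
Definition met_dist (X Y : Met) : \bar R := rough_dist (repr X) (repr Y).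

Lemma met_dist_pi (g h : roughMetric M) :
  met_dist (\pi_Met g) (\pi_Met h) = rough_dist g h.
Proof.
by apply: rough_dist_ae; apply/asboolP/(@eqmodP _ (ae_equiv M)); rewrite reprK.
Qed.

Definition met_ball (X : Met) (r : R) : set Met :=
  [set Y | (met_dist X Y < r%:E)%E].

Definition met_ent : set_system (Met * Met) := entourage_ met_ball.

Definition met_nbhs (X : Met) : set_system Met := nbhs_ met_ent X.

HB.instance Definition _ := hasNbhs.Build Met met_nbhs.

Lemma met_nbhsE : @nbhs Met Met = nbhs_ met_ent. Proof. by []. Qed.

Lemma met_ball_center (X : Met) (r : R) : 0 < r -> met_ball X r X.
Proof. by move=> r0; rewrite /met_ball /= /met_dist rough_dist_refl lte_fin. Qed.

Lemma met_ball_sym (X Y : Met) (r : R) : met_ball X r Y -> met_ball Y r X.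
Proof. by rewrite /met_ball /= /met_dist rough_distC. Qed.

Lemma met_ball_triangle (X Y Z : Met) (r s : R) :
  met_ball X r Y -> met_ball Y s Z -> met_ball X (r + s) Z.
Proof. exact: rough_dist_triangle. Qed.

HB.instance Definition _ := @Nbhs_isPseudoMetric.Build R Met
  met_ent met_nbhsE met_ball met_ball_center met_ball_sym met_ball_triangle erefl.

End Met.

(* Main.v *)
From HB Require Import structures.
Require Import Defs.
From mathcomp Require Import all_boot all_order all_algebra.
From mathcomp Require Import sesquilinear.
From mathcomp Require Import all_classical all_reals all_analysis.
From mathcomp Require Import measurable_realfun finmap lra ring.
Import Order.TTheory GRing.Theory Num.Theory.
Import numFieldNormedType.Exports.

Set Implicit Arguments.
Unset Strict Implicit.
Unset Printing Implicit Defensive.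

Local Open Scope classical_set_scope.
Local Open Scope ring_scope.

(** If M is compact, any two rough metrics g and h are globally comparable:
    both are comparable to chart metrics near every point, two chart metrics
    at a point are comparable because the Jacobian of the transition map is
    continuous, and finitely many neighbourhoods suffice.  When h <= D^2 g
    almost everywhere, the ray s |-> g + |s| h is Lipschitz for the distance
    between metrics, since g + s h <= (1 + |s - t| D^2) (g + t h).  This ray
    joins g to g + h, the symmetric ray joins h to g + h, and so the space
    of metrics is connected (compact_connected_Met).  Using unbounded rays
    and the common end g + h, rather than the segment from g to h, makes the
    path defined for every real parameter.

    If M is not compact, exhaust it by a sequence of compact sets K_i, each
    inside the domain of a chart c_i, whose interiors cover M.  On the set of
    points for which i is the least index with the point in the interior of
    K_i, take the Euclidean metric of c_i with norms multiplied by a constant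
    W_i > 0.  Only finitely many pieces come near a given point, so this is a
    rough metric whatever the sequence W (piece_metric): measurable tensors
    may jump between pieces, so that a partition into measurable sets can do
    the work of a partition of unity.  The sequences
    W_i = 1 and W_i = i + 1 give two metrics which are not comparable with
    any constant: the complement of finitely many K_i is a nonempty open set,
    hence not a null set, and carries nonzero tangent vectors if the dimension
    is positive.  As a connected pseudometric space has no two points at
    infinite distance (connected_bounded), the space of metrics is then
    disconnected.  In dimension 0 a connected manifold is at most a point.

    The measure theory behind the second half is that nonempty open sets of
    R^n are not null (nbhs_not_lebesgue_null).  It is proved by counting
    lattice points: a cover of a cube by finitely many boxes must cover all
    the points of a fine grid. *)

(** * Nonempty open sets are not null *)
Section NullSets.
Variables (R : realType) (n : nat).

(** If m grid points lie in the interval, the extreme ones are at distance at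
    least (m - 1) d. *)
Lemma card_grid_itv (N : nat) (x d a b : R) : 0 < d ->
  #|[pred k : 'I_N | a <= x + k%:R * d <= b]|%:R * d <= Num.max 0 (b - a) + d.
Proof.
move=> d0; set S := [pred k : 'I_N | _].
have [/existsP[k Sk]|] := boolP [exists k, S k]; last first.
  rewrite negb_exists => /forallP S0; rewrite (eq_card0 (A := S)); last first.
    by move=> k; apply/negbTE/S0.
  by rewrite mul0r addr_ge0 ?le_max ?lexx // ltW.
have [m Sm mle] := arg_minnP (fun i : 'I_N => i : nat) Sk.
have [M SM leM] := arg_maxnP (fun i : 'I_N => i : nat) Sk.
have mM : (m <= M)%N := mle M SM.
have cS : (#|S| <= (M - m).+1)%N.
  rewrite cardE -(size_map val) -(size_iota m (M - m).+1).
  apply: uniq_leq_size; first by rewrite map_inj_uniq ?enum_uniq //; exact: val_inj.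
  move=> _ /mapP[i + ->]; rewrite mem_enum => Si.
  by rewrite mem_iota mle //= addnS ltnS subnKC //; exact: leM.
apply: (@le_trans _ _ ((M - m).+1%:R * d)).
  by rewrite ler_pM2r // ler_nat.
rewrite -addn1 natrD mulrDl mul1r lerD2r natrB // le_max; apply/orP; right.
have /andP[am _] := Sm; have /andP[_ Mb] := SM.
by rewrite mulrBl; lra.
Qed.

(** Room for enlarging a box: d on each of the two sides in order to cover by
    interiors, and d once more for the error made by counting grid points. *)
Lemma box_volume_margin (p : 'rV[R]_n * 'rV[R]_n) (e : R) : 0 < e ->
  exists2 d, 0 < d &
    \prod_i (Num.max 0 (p.2 0 i - p.1 0 i) + 3 * d) <= box_volume p + e.
Proof.
move=> e0.
have cv : (fun d : R => \prod_i (Num.max 0 (p.2 0 i - p.1 0 i) + 3 * d)) d @[d --> 0^'+]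
   --> \prod_i (Num.max 0 (p.2 0 i - p.1 0 i)).
  apply: cvg_at_right_filter; apply: (@cvg_big R _ *%R 1 xpredT (@mul_continuous R)) => i _.
  rewrite -[X in _ --> X]addr0; apply: cvgD; first exact: cvg_cst.
  rewrite -[X in _ --> X](mulr0 3); apply: cvgM; first exact: cvg_cst.
  exact: cvg_id.
have : \forall d \near 0^'+,
    \prod_i (Num.max 0 (p.2 0 i - p.1 0 i) + 3 * d) < box_volume p + e.
  by apply: (cvgr_lt _ cv); rewrite ltrDl.
move=> H.
have [d [/= d0 dH]] : exists d : R, d > 0 /\ \prod_i (Num.max 0 (p.2 0 i - p.1 0 i) + 3 * d) < box_volume p + e.
  near (0:R)^'+ => d; exists d; split; near: d => //. 
  exact: nbhs_right_gt.
by exists d => //; exact: ltW.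
Unshelve. all: by end_near. Qed.

Definition cube (x : 'rV[R]_n) (r : R) := box (x - const_mx r, x + const_mx r).

Lemma compact_box (p : 'rV[R]_n * 'rV[R]_n) : compact (box p).
Proof. 
have := @rV_compact R n (fun i => `[p.1 0 i, p.2 0 i]%classic) (fun i => @segment_compact _ _ _).
by congr compact; apply/seteqP; split=> x /= H i; have := H i; rewrite /= in_itv /=.
Qed.

Lemma cubeP x r y : cube x r y <-> forall i, `|x 0 i - y 0 i| <= r.
Proof.
split=> H i; have := H i; rewrite !mxE ?ler_distlC ?ler_distl /=; lra.
Qed.

Lemma nbhs_cube (x : 'rV[R]_n) (r : R) : 0 < r -> nbhs x (cube x r).
Proof.
move=> r0; apply/nbhs_ballP; exists r => //= y xy; apply/cubeP => i.
by apply: ltW; case: xy => _ /(_ 0 i).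
Qed.

Lemma cube_sub_nbhs (x : 'rV[R]_n) (A : set 'rV[R]_n) : nbhs x A ->
  exists2 r, 0 < r & cube x r `<=` A.
Proof.
move=> /nbhs_ballP[e /= e0 eA]; exists (e / 2); first by rewrite divr_gt0.
move=> y /cubeP xy; apply: eA; split => // i j; rewrite (ord1 i).
by apply: le_lt_trans (xy j) _; rewrite /=; lra.
Qed.

(** A cube of side L contains a grid of N^n points with step L / N.  Each of
    them lies in one of the boxes, and a box contains at most as many grid
    points as card_grid_itv allows in each direction. *)
Lemma grid_cover (s : seq ('rV[R]_n * 'rV[R]_n)) (x : 'rV[R]_n) (L : R) (N : nat) :
  0 < L -> (0 < N)%N ->
  box (x, x + const_mx L) `<=` \bigcup_(p in [set` s]) box p ->
  L ^+ n <= \sum_(p <- s) \prod_i (Num.max 0 (p.2 0 i - p.1 0 i) + L / N%:R).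
Proof.
move=> L0 N0 cov; set d := L / N%:R.
have N0' : 0 < N%:R :> R by rewrite ltr0n.
have d0 : 0 < d by rewrite divr_gt0.
pose pt (k : {ffun 'I_n -> 'I_N}) : 'rV[R]_n := \row_i (x 0 i + (k i)%:R * d).
pose In (p : 'rV[R]_n * 'rV[R]_n) : pred {ffun 'I_n -> 'I_N} := [pred k | `[< box p (pt k) >]].
have cIn p : #|In p|%:R * d ^+ n <= \prod_i (Num.max 0 (p.2 0 i - p.1 0 i) + d).
  pose F i : pred 'I_N := [pred k : 'I_N | p.1 0 i <= x 0 i + k%:R * d <= p.2 0 i].
  have -> : #|In p| = (\prod_i #|F i|)%N.
    have := card_family F; rewrite foldrE big_image /= => <-; apply: eq_card => k; rewrite !inE.
    apply/asboolP/familyP => [H i|H i]; have := H i; by rewrite !mxE inE.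
  rewrite natr_prod -[n in d ^+ n]card_ord -prodr_const -big_split /=.
  by apply: ler_prod => i _; rewrite mulr_ge0 ?ler0n ?(ltW d0) ?card_grid_itv.
have tot : (N ^ n <= \sum_(p <- s) #|In p|)%N.
  have <- : #|{ffun 'I_n -> 'I_N}| = (N ^ n)%N by rewrite card_ffun !card_ord.
  rewrite -sum1_card.
  under [leqRHS]eq_bigr do rewrite -sum1_card big_mkcond /=.
  rewrite exchange_big /=; apply: leq_sum => k _.
  have [p /= ps kp] : (\bigcup_(p in [set` s]) box p) (pt k).
    apply: cov => i; rewrite !mxE /= lerDl mulr_ge0 ?ler0n ?(ltW d0) //= lerD2l.
    rewrite /d mulrCA ger_pMr // ler_pdivrMr // mul1r ler_nat.
    exact/ltnW.
  rewrite (big_rem p) //= inE.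
  by have -> : `[< box p (pt k) >] by apply/asboolP.
have -> : L ^+ n = (N ^ n)%:R * d ^+ n.
  by rewrite natrX -exprMn mulrC divfK // gt_eqF.
apply: (@le_trans _ _ (\sum_(p <- s) #|In p|%:R * d ^+ n)).
  by rewrite -mulr_suml -natr_sum ler_wpM2r ?exprn_ge0 ?(ltW d0) // ler_nat.
exact: ler_sum.
Qed.

End NullSets.

(** Distributes an error term over countably many boxes. *)
Lemma sum_uniq_geometric_le1 (R : realFieldType) (l : seq nat) : uniq l ->
  \sum_(k <- l) 2 ^- k.+1 <= 1 :> R.
Proof.
move=> ul; have [m lm] : exists m, forall k, k \in l -> (k < m)%N.
  by exists (\max_(k <- l) k).+1 => k kl; rewrite ltnS; exact: leq_bigmax_seq.
have E : \sum_(k <- iota 0 m) 2 ^- k.+1 = 1 - 2 ^- m :> R.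
  elim: m {lm} => [|m IH]; first by rewrite big_nil expr0 invr1 subrr.
  rewrite -addn1 iotaD big_cat IH /= add0n big_seq1 addn1.
  have := @exprS R 2 m => ->; have : 2 ^+ m != 0 :> R by rewrite expf_neq0.
  by move=> ?; field.
apply: (@le_trans _ _ (1 - 2 ^- m)); last first.
  by rewrite gerBl invr_ge0 exprn_ge0.
rewrite -E [leRHS](bigID (mem l)) /= -[leLHS]addr0 lerD //; last first.
  by apply: sumr_ge0 => i _; rewrite invr_ge0 exprn_ge0.
rewrite -[in leRHS]big_filter le_eqVlt; apply/orP; left; apply/eqP/perm_big.
apply: uniq_perm; rewrite ?filter_uniq ?iota_uniq // => k.
by rewrite mem_filter mem_iota /= andb_idr // => /lm.
Qed.

(** Suppose a cube of volume L^n is covered by countably many boxes of total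
    volume at most e = L^n / 4.  Enlarging the boxes by a total of at most e,
    compactness leaves finitely many of them, and grid_cover gives
    L^n <= 2 e for a grid that is fine compared to all the margins. *)
Lemma nbhs_not_lebesgue_null (R : realType) (n : nat) (x : 'rV[R]_n)
  (A : set 'rV[R]_n) : nbhs x A -> ~ lebesgue_null A.
Proof.
move=> /cube_sub_nbhs[r r0 rA] /(lebesgue_nullS rA).
pose L := r + r; have L0 : 0 < L by rewrite addr_gt0.
have Ln0 : 0 < L ^+ n by rewrite exprn_gt0.
(* Any value below L^n / 2 would do: the contradiction is L^n <= e + e. *)
pose e := L ^+ n / 4; have e0 : 0 < e by rewrite divr_gt0.
move=> /(_ _ e0)[S [/countable_injP[phi phiI] cov Se]].
have /choice[d dP] : forall p : 'rV[R]_n * 'rV[R]_n, exists d, 0 < d /\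
    \prod_i (Num.max 0 (p.2 0 i - p.1 0 i) + 3 * d) <=
      box_volume p + e * 2 ^- (phi p).+1.
  move=> p; have e1 : 0 < e * 2 ^- (phi p).+1 by rewrite mulr_gt0 // invr_gt0 exprn_gt0.
  by have [d d0 dp] := box_volume_margin p e1; exists d.
pose enl (p : 'rV[R]_n * 'rV[R]_n) := (p.1 - const_mx (d p), p.2 + const_mx (d p)).
have box_enl p : box p `<=` (box (enl p))^°.
  move=> y py; apply: filterS (nbhs_cube y (dP p).1) => z /cubeP yz i.
  by have := py i; have := yz i; rewrite /= !mxE ler_distlC; lra.
have cpt : cover_compact (cube x r) by rewrite -compact_cover; exact: compact_box.
have [D DS Dcov] : finite_subset_cover S (fun p => (box (enl p))^°) (cube x r).
  apply: cpt => [p _|y /cov[p Sp py]]; first exact: open_interior.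
  by exists p => //; exact: box_enl.
(* The grid step L / N is below every margin d p. *)
pose N := (Num.truncn (\sum_(p <- D) L / d p)).+1.
have LN p : p \in D -> L / N%:R <= d p.
  move=> pD; rewrite ler_pdivrMr ?ltr0n // mulrC -ler_pdivrMr ?(dP p).1 //.
  apply: le_trans (ltW (truncnS_gt _)).
  rewrite (big_rem p) //= lerDl; apply: sumr_ge0 => q _.
  by rewrite divr_ge0 ?ltW // (dP q).1.
have := @grid_cover R n [seq enl p | p <- D] (x - const_mx r) L N L0 isT.
have -> : x - const_mx r + const_mx L = x + const_mx r.
  by apply/rowP => i; rewrite !mxE /L; ring.
have H : cube x r `<=` \bigcup_(p in [set` [seq enl p | p <- D]]) box p.
  move=> y /Dcov[p /= pD /interior_subset py]; exists (enl p) => //=.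
  by apply/mapP; exists p.
move=> /(_ H); rewrite big_map; apply/negP; rewrite -ltNge.
apply: (@le_lt_trans _ _ (\sum_(p <- D) (box_volume p + e * 2 ^- (phi p).+1))).
  rewrite big_seq [leRHS]big_seq; apply: ler_sum => p pD.
  apply: le_trans (dP p).2; apply: ler_prod => i _.
  have dp0 := (dP p).1; have L0' := ltW L0; rewrite addr_ge0 ?le_max ?lexx ?divr_ge0 //=.
  have := LN p pD; rewrite !mxE /= => LNp.
  have : Num.max 0 (p.2 0 i + d p - (p.1 0 i - d p)) <=
         Num.max 0 (p.2 0 i - p.1 0 i) + 2 * d p.
    rewrite ge_max; apply/andP; split; first by apply: addr_ge0; rewrite ?le_max ?lexx // mulr_ge0 // ltW.
    have : p.2 0 i - p.1 0 i <= Num.max 0 (p.2 0 i - p.1 0 i) by rewrite le_max lexx orbT.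
    lra.
  lra.
rewrite big_split /= -mulr_sumr.
have D1 : \sum_(p <- D) box_volume p <= e.
  rewrite -lee_fin; apply: le_trans Se; apply: ereal_sup_ubound.
  exists [set` D]; first by split=> // p /= /DS /set_mem.
  by rewrite -fsbig_seq ?fset_uniq ?sumEFin.
have D2 : \sum_(p <- D) 2 ^- (phi p).+1 <= 1 :> R.
  rewrite -(big_map phi xpredT (fun k => 2 ^- k.+1)) /=.
  apply: sum_uniq_geometric_le1; rewrite map_inj_in_uniq ?fset_uniq //.
  by move=> p q /DS pS /DS qS; exact: phiI.
have : e * \sum_(p <- D) 2 ^- (phi p).+1 <= e by rewrite ger_pMr.
move: Ln0 D1; rewrite /e; lra.
Qed.

(** * Charts and tangent vectors *)
Section ChartTopology.
Variables (R : realType) (n : nat) (M : topologicalType).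
Variables (c : chart R n M) (cP : is_chart c).

Lemma chart_dom_open : open (chart_dom c). Proof. by case: cP. Qed.
Lemma chart_img_open : open (chart_img c). Proof. by case: cP. Qed.

Lemma chart_mapK x : chart_dom c x -> chart_inv c (c x) = x.
Proof. by case: cP => _ _ _ _; apply. Qed.

Lemma chart_continuous x : chart_dom c x -> {for x, continuous c}.
Proof.
move=> cx; case: cP => oD _ cc _ _; move: cc.
by rewrite continuous_open_subspace // => /(_ x); apply; exact/mem_set.
Qed.

Lemma chart_inv_continuous y : chart_img c y -> {for y, continuous (chart_inv c)}.
Proof.
move=> cx; case: cP => _ oD _ cc _; move: cc.
by rewrite continuous_open_subspace // => /(_ y); apply; exact/mem_set.
Qed.

Lemma chart_nbhs x : chart_dom c x -> nbhs x (chart_dom c).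
Proof. by move=> cx; apply: open_nbhs_nbhs; split=> //; exact: chart_dom_open. Qed.

Lemma image_chartE (V : set M) :
  c @` (V `&` chart_dom c) = chart_img c `&` chart_inv c @^-1` V.
Proof.
apply/seteqP; split=> [_ [x [Vx cx] <-]|_ [[x cx <-] /= Vx]].
  by split; [exists x|rewrite /= chart_mapK].
by exists x => //; split => //; rewrite chart_mapK in Vx.
Qed.

Lemma open_image_chart (V : set M) : open V -> open (c @` (V `&` chart_dom c)).
Proof.
move=> oV; rewrite openE => _ [x [Vx cx] <-]; rewrite /interior.
rewrite image_chartE; apply: filterI.
  by apply: open_nbhs_nbhs; split; [exact: chart_img_open|exists x].
apply: chart_inv_continuous; first by exists x.
by rewrite chart_mapK //; exact: open_nbhs_nbhs.
Qed.

Lemma compact_chart_nbhs x : chart_dom c x ->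
  exists K, [/\ compact K, K `<=` chart_dom c & nbhs x K].
Proof.
move=> cx; have : nbhs (c x) (chart_img c).
  by apply: open_nbhs_nbhs; split; [exact: chart_img_open|exists x].
move=> /cube_sub_nbhs[r r0 rI]; exists (chart_inv c @` cube (c x) r); split.
- apply: continuous_compact; last exact: compact_box.
  apply: continuous_in_subspaceT => y /set_mem/rI.
  exact: chart_inv_continuous.
- by move=> _ [y /rI[z cz <-] <-]; rewrite chart_mapK.
- have := chart_continuous cx (nbhs_cube _ r0) => H.
  by apply: filterS2 (chart_nbhs cx) H => y cy yr; exists (c y) => //; rewrite chart_mapK.
Qed.

End ChartTopology.

Lemma Ck_subset (R : realType) (m n k : nat) (U V : set 'rV[R]_m)
    (f : 'rV[R]_m -> 'rV[R]_n) : V `<=` U -> Ck k U f -> Ck k V f.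
Proof.
move=> VU; elim: k f => [|k IH] f /=; first by move=> H x /VU; exact: H.
by move=> [df dDf]; split=> [x /VU /df //|v]; exact: IH.
Qed.

(** Continuity at a point only depends on the germ. *)
Lemma continuous_at_near (T U : topologicalType) (f g : T -> U) (a : T) :
  (\forall y \near a, f y = g y) -> {for a, continuous g} -> {for a, continuous f}.
Proof.
move=> fg; rewrite /prop_for /continuous_at => cg.
have -> : f a = g a by exact: nbhs_singleton fg.
apply: cvg_trans cg; apply: near_eq_cvg.
by apply: filterS fg => y ->.
Qed.

(** The chain rule for a map h that is the composite of g and f only near a,
    as happens for transition maps, which compose only on the overlap of three
    chart domains. *)
Lemma jacobian_comp_near (R : realType) (m n p : nat) (f : 'rV[R]_m -> 'rV[R]_n)
    (g : 'rV[R]_n -> 'rV[R]_p) (h : 'rV[R]_m -> 'rV[R]_p) a b : f a = b ->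
  differentiable f a -> differentiable g b -> differentiable h a ->
  (\near a, h a = (g \o f) a) ->
  jacobian h a = jacobian f a *m jacobian g b.
Proof.
move=> <- df dg dh E; have ED v : 'D_v h a = 'D_v (g \o f) a by exact: near_eq_derive.
have EC v : 'D_v (g \o f) a = 'D_('D_v f a) g (f a).
  have dgf := differentiable_comp df dg.
  rewrite (deriveE v dgf) (diff_comp df dg).
  rewrite (deriveE v df).
  by rewrite (deriveE _ dg).
apply/row_matrixP => i; rewrite !rowE.
transitivity ('D_('D_(delta_mx 0 i) f a) g (f a)).
  by rewrite -EC -ED deriveEjacobian.
by rewrite deriveEjacobian // [in LHS]deriveEjacobian // mulmxA.
Qed.

Section TangentSpaces.
Variables (R : realType) (n : nat) (M : smoothManifold R n).
Implicit Types (x : M) (c : chart R n M).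

Lemma transitionE c c' x : atlas c -> chart_dom c x -> transition c c' (c x) = c' x.
Proof. by move=> /atlas_chart cP cx; rewrite /transition /= chart_mapK. Qed.

Lemma transition_differentiable c c' x : charts_at x c -> charts_at x c' ->
  differentiable (transition c c') (c x).
Proof.
move=> [cM cx] [c'M c'x]; have [df _] := atlas_smooth cM c'M 1.
by apply: df; exists x.
Qed.

Lemma mul_jacobian c c' x v : charts_at x c -> charts_at x c' ->
  v *m jacobian (transition c c') (c x) = 'D_v (transition c c') (c x).
Proof.
by move=> xc xc'; rewrite deriveEjacobian //; exact: transition_differentiable.
Qed.

(** This cocycle identity is what makes the relations between the coordinates
    of a tangent vector compatible. *)
Lemma jacobian_trans c c' c'' x : charts_at x c -> charts_at x c' -> charts_at x c'' ->
  jacobian (transition c c'') (c x) =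
  jacobian (transition c c') (c x) *m jacobian (transition c' c'') (c' x).
Proof.
move=> xc xc' xc''; have [cM cx] := xc; have [c'M c'x] := xc'; have [c''M c''x] := xc''.
apply: jacobian_comp_near; first exact: transitionE.
- exact: transition_differentiable.
- exact: transition_differentiable.
- exact: transition_differentiable.
have : (c @` (chart_dom c' `&` chart_dom c)) (c x) by exists x.
have := open_image_chart (atlas_chart cM) (chart_dom_open (atlas_chart c'M)).
rewrite openE => H /H; apply: filterS => _ [z [c'z cz] <-].
by rewrite /= !transitionE.
Qed.

Lemma jacobian_transition_id c x : charts_at x c -> jacobian (transition c c) (c x) = 1%:M.
Proof.
move=> xc; have [cM cx] := xc.
apply/row_matrixP => i; rewrite !rowE mulmx1 (mul_jacobian _ xc xc).
rewrite (@near_eq_derive _ _ _ _ id) ?derive_id //.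
have : (c @` chart_dom c) (c x) by exists x.
have := chart_img_open (atlas_chart cM).
rewrite openE => H /H; apply: filterS => _ [z cz <-].
by rewrite transitionE.
Qed.

Lemma tangent_coordE c c' x (u : tangent x) : charts_at x c -> charts_at x c' ->
  tangent_coord c' u = tangent_coord c u *m jacobian (transition c c') (c x).
Proof. by move=> xc xc'; have /asboolP[H _] := tangentP u; exact: H. Qed.

(** A prescribed coordinate vector v in one chart determines a coherent family:
    transport v by the Jacobians, coherence being jacobian_trans.  In
    particular tangent spaces are nonzero in positive dimension. *)
Lemma tangent_coord_surj c x v : charts_at x c ->
  exists u : tangent x, tangent_coord c u = v.
Proof.
move=> xc; pose F c' := if pselect (charts_at x c') then
  v *m jacobian (transition c c') (c x) else 0.
have FP : F \in tangent_family x.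
  apply/asboolP; split=> [c1 c2 x1 x2|c1 x1]; rewrite /F.
    case: (pselect (charts_at x c1)) => [{}x1|//].
    case: (pselect (charts_at x c2)) => [{}x2|//].
    by rewrite -mulmxA; congr (_ *m _); exact: jacobian_trans.
  by case: (pselect (charts_at x c1)).
exists (Tangent FP); rewrite /tangent_coord /= /F.
by case: (pselect (charts_at x c)) => // ?; rewrite jacobian_transition_id // mulmx1.
Qed.

(** The rows of the Jacobian are the directional derivatives along the standard
    basis, which are continuous as the transition map is of class C^1. *)
Lemma jacobian_continuous c c' x i j : charts_at x c -> charts_at x c' ->
  {for c x, continuous (fun y => jacobian (transition c c') y i j)}.
Proof.
move=> xc xc'; have [cM cx] := xc; have [c'M c'x] := xc'.
have [_ dC0] := atlas_smooth cM c'M 1; have dC := dC0 (delta_mx 0 i).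
have Ox : (c @` (chart_dom c' `&` chart_dom c)) (c x) by exists x.
have E : \forall y \near c x, jacobian (transition c c') y i j =
    ('D_(delta_mx 0 i) (transition c c') y) 0 j.
  have := open_image_chart (atlas_chart cM) (chart_dom_open (atlas_chart c'M)).
  rewrite openE => H; have := H _ Ox; apply: filterS => _ [z [c'z cz] <-].
  have zc : charts_at z c by split.
  have zc' : charts_at z c' by split.
  by rewrite -(mul_jacobian _ zc zc') -rowE [RHS]mxE.
apply: (continuous_at_near E).
apply: (@continuous_comp _ _ _ _ (fun v : 'rV_n => v 0 j)); first by apply: dC; exists x.
exact: coord_continuous.
Qed.

End TangentSpaces.

(** * Comparison of chart metrics *)
Section EuclideanNorm.
Variables (R : realType) (n : nat).
Implicit Types v : 'rV[R]_n.

Lemma enorm_ge0 v : 0 <= enorm v. Proof. exact: sqrtr_ge0. Qed.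

Lemma sqr_enorm v : enorm v ^+ 2 = (v *m v^T) 0 0.
Proof.
rewrite sqr_sqrtr; last by apply: sumr_ge0 => i _; exact: sqr_ge0.
by rewrite mxE; apply: eq_bigr => i _; rewrite mxE expr2.
Qed.

Lemma ler_enorm_coord v i : `|v 0 i| <= enorm v.
Proof.
rewrite -sqrtr_sqr ler_wsqrtr // (bigD1 i) //= lerDl.
by apply: sumr_ge0 => j _; exact: sqr_ge0.
Qed.

Lemma enorm_eq0 v : enorm v = 0 -> v = 0.
Proof.
move=> v0; apply/rowP => i; apply/eqP; rewrite mxE -normr_le0 -v0.
exact: ler_enorm_coord.
Qed.

Lemma ler_enorm_sum v : enorm v <= \sum_i `|v 0 i|.
Proof.
have s0 : 0 <= \sum_i `|v 0 i| by exact: sumr_ge0.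
rewrite -[leRHS]ger0_norm // -sqrtr_sqr ler_wsqrtr // expr2 mulr_suml.
apply: ler_sum => i _; rewrite -real_normK ?num_real // expr2 ler_wpM2l //.
by rewrite (bigD1 i) //= lerDl; exact: sumr_ge0.
Qed.

(** A bound for the operator norm that is visibly continuous in A. *)
Definition entry_sum (A : 'M[R]_n) : R := \sum_i \sum_j `|A i j|.

Lemma enorm_mulmx v (A : 'M[R]_n) : enorm (v *m A) <= entry_sum A * enorm v.
Proof.
apply: le_trans (ler_enorm_sum _) _; rewrite /entry_sum exchange_big /= mulr_suml.
apply: ler_sum => j _; rewrite mxE mulr_suml; apply: le_trans (ler_norm_sum _ _ _) _.
apply: ler_sum => i _; rewrite normrM mulrC ler_wpM2l //.
exact: ler_enorm_coord.
Qed.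

End EuclideanNorm.

(** The complements of the sets that satisfy P form a filter; if it were
    proper it would have a cluster point, and the neighbourhood with property
    P of this point would contradict clustering. *)
Lemma compact_induction (T : topologicalType) (P : set T -> Prop) :
  compact [set: T] -> P set0 -> (forall A B, A `<=` B -> P B -> P A) ->
  (forall A B, P A -> P B -> P (A `|` B)) ->
  (forall x : T, exists2 A, nbhs x A & P A) -> P setT.
Proof.
move=> cT P0 PS PU PN; apply: contrapT => NT.
pose F : set_system T := [set A | P (~` A)].
have FF : ProperFilter F.
  split; first by rewrite /F /= setC0.
  split; rewrite /F.
  - by rewrite /= setCT.
  - by move=> A B PA PB; rewrite /= setCI; exact: PU.
  - by move=> A B AB; apply: PS; exact: subsetC.
have [|x [_ /= clx]] := cT F FF; first by rewrite /F /= setCT.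
have [A xA PA] := PN x.
have FA : F (~` A) by rewrite /F /= setCK.
by have [y [/= nAy /nAy]] := clx (~` A) A FA xA.
Qed.

Lemma continuous_at_sum (R : realType) (T : topologicalType) (I : finType)
    (f : I -> T -> R) (a : T) : (forall i, {for a, continuous (f i)}) ->
  {for a, continuous (fun y => \sum_i f i y)}.
Proof.
move=> fa; apply: (@cvg_big R I +%R 0 xpredT (@add_continuous R) T (nbhs a)
  (index_enum I) f (fun i => f i a)) => i _; exact: fa.
Qed.

Section ChartsAndNullSets.
Variables (R : realType) (n : nat) (M : smoothManifold R n).
Implicit Types (x : M) (c : chart R n M).

(** Two chart metrics at x are comparable near x, because the Jacobian of the
    transition map is continuous, hence bounded, near c x. *)
Lemma pullback_norm_bound c c' x : charts_at x c -> charts_at x c' ->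
  exists2 K : R, 1 <= K & \forall y \near x, forall u : tangent y,
    pullback_norm c' u <= K * pullback_norm c u.
Proof.
move=> xc xc'; have [cM cx] := xc; have [c'M c'x] := xc'.
pose S y := entry_sum (jacobian (transition c c') y).
have cS : {for c x, continuous S}.
  apply: continuous_at_sum => i; apply: continuous_at_sum => j.
  apply: (@continuous_comp _ _ _ (fun y => jacobian (transition c c') y i j)).
    exact: jacobian_continuous.
  exact: norm_continuous.
have S0 y : 0 <= S y by apply: sumr_ge0 => i _; apply: sumr_ge0.
exists (S (c x) + 1); first by rewrite lerDr.
have cxS : \forall y \near x, S (c y) < S (c x) + 1.
  have Sz : \forall z \near c x, S z < S (c x) + 1.
    by apply: (cvgr_lt _ cS); rewrite ltrDl.
  exact: (chart_continuous (atlas_chart cM) cx Sz).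
near=> y => u.
have cy : charts_at y c by split=> //; near: y; exact: (chart_nbhs (atlas_chart cM)).
have c'y : charts_at y c' by split=> //; near: y; exact: (chart_nbhs (atlas_chart c'M)).
rewrite /pullback_norm (tangent_coordE u cy c'y).
apply: le_trans (enorm_mulmx _ _) _; apply: ler_wpM2r; first exact: enorm_ge0.
by apply: ltW; near: y.
Unshelve. all: by end_near. Qed.

Definition restrict_chart c (W : set M) : chart R n M :=
  Chart (W `&` chart_dom c) c (chart_inv c).

(** By maximality of the atlas: transition maps of the restricted chart are
    restrictions of transition maps of c. *)
Lemma restrict_chart_atlas c (W : set M) : atlas c -> open W ->
  atlas (restrict_chart c W).
Proof.
move=> cM oW; have cP := atlas_chart cM; apply: atlas_maximal.
  have sub : c @` (W `&` chart_dom c) `<=` chart_img c by move=> _ [x [_ cx] <-]; exists x.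
  split=> /=.
  - by apply: openI => //; exact: chart_dom_open.
  - exact: open_image_chart.
  - apply: continuous_in_subspaceT => x /set_mem[_ cx].
    exact: chart_continuous.
  - apply: continuous_in_subspaceT => y /set_mem/sub.
    exact: chart_inv_continuous.
  - by move=> x [_ cx]; exact: chart_mapK.
move=> c' c'M; split=> k.
  apply: Ck_subset (atlas_smooth cM c'M k).
  by move=> _ [x [[_ cx] c'x] <-]; exists x.
apply: Ck_subset (atlas_smooth c'M cM k).
by move=> _ [x [c'x [_ cx]] <-]; exists x.
Qed.

Lemma almost_every_subset (A B : set M) P : A `<=` B -> almost_every B P -> almost_every A P.
Proof.
move=> AB aP c cM; apply: lebesgue_nullS (aP c cM).
by apply: image_subset => x [[/AB Bx nP] xc].
Qed.

Lemma almost_everyU (A B : set M) P : almost_every A P -> almost_every B P ->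
  almost_every (A `|` B) P.
Proof.
move=> aA aB c cM; apply: lebesgue_nullS (lebesgue_nullU (aA c cM) (aB c cM)).
by move=> _ [x [[[Ax|Bx] nP] xc] <-]; [left|right]; exists x.
Qed.

Lemma almost_every_set0 P : almost_every (set0 : set M) P.
Proof.
move=> c cM; apply: lebesgue_nullS (@lebesgue_null0 _ _).
by move=> _ [x [[[] _] _] _].
Qed.

Lemma open_measure_zero (U : set M) : open U -> measure_zero U -> U = set0.
Proof.
move=> oU U0; apply/seteqP; split=> // x Ux.
have [c cM cx] := atlas_cover x.
apply: (@nbhs_not_lebesgue_null _ _ (c x)) (U0 c cM).
apply: open_nbhs_nbhs; split; last by exists x.
by apply: open_image_chart => //; exact: atlas_chart.
Qed.

End ChartsAndNullSets.

(** * Compact manifolds have connected spaces of metrics *)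
Section RealInequalities.
Variable R : realType.
Implicit Types a b D K s t : R.

Lemma ler_sqrt_mul a b K : 0 <= K -> a <= K ^+ 2 * b -> Num.sqrt a <= K * Num.sqrt b.
Proof.
move=> K0 ab; rewrite -[K in leRHS]ger0_norm // -sqrtr_sqr -sqrtrM ?sqr_ge0 //.
exact: ler_wsqrtr.
Qed.

Lemma ler_sqr_sqrt a b K : 0 <= a -> 0 <= b ->
  Num.sqrt a <= K * Num.sqrt b -> a <= K ^+ 2 * b.
Proof.
move=> a0 b0 ab; rewrite -(sqr_sqrtr a0) -(sqr_sqrtr b0) -exprMn.
by rewrite ler_sqr ?nnegrE ?sqrtr_ge0 // (le_trans _ ab) ?sqrtr_ge0.
Qed.

(** The Lipschitz estimate along the ray g + s h, with a and b the values of
    g and h on a tangent vector. *)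
Lemma sqrt_affine_le a b D s t : 0 <= a -> 0 <= b -> 0 <= t -> b <= D ^+ 2 * a ->
  Num.sqrt (a + s * b) <= (1 + `|s - t| * D ^+ 2) * Num.sqrt (a + t * b).
Proof.
move=> a0 b0 t0 ba; have d0 : 0 <= `|s - t| by [].
have DD : 0 <= D ^+ 2 by exact: sqr_ge0.
apply: ler_sqrt_mul; first by rewrite addr_ge0 // mulr_ge0.
have st : s * b <= t * b + `|s - t| * b.
  by rewrite -mulrDl ler_wpM2r // -lerBlDl ler_norm.
have db : `|s - t| * b <= `|s - t| * D ^+ 2 * (a + t * b).
  rewrite -mulrA ler_wpM2l //; apply: le_trans ba _.
  by rewrite ler_wpM2l // lerDl mulr_ge0.
apply: (@le_trans _ _ ((1 + `|s - t| * D ^+ 2) * (a + t * b))); first lra.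
have w0 : 0 <= `|s - t| * D ^+ 2 by rewrite mulr_ge0.
rewrite ler_wpM2r ?addr_ge0 ?mulr_ge0 // expr2.
by rewrite ler_peMr ?lerDl // addr_ge0.
Qed.

End RealInequalities.

Section Metrics.
Variables (R : realType) (n : nat) (M : smoothManifold R n).
Implicit Types (x : M) (c : chart R n M) (g h : roughMetric M).

Lemma almost_every_imply (A : set M) (P Q : M -> Prop) :
  (forall x, A x -> P x -> Q x) -> almost_every A P -> almost_every A Q.
Proof.
move=> PQ aP c cM; apply: lebesgue_nullS (aP c cM).
by apply: image_subset => x [[Ax nQ] xc]; split=> //; split=> // /(PQ _ Ax).
Qed.

Lemma pullback_norm_eq0 c x (u : tangent x) : charts_at x c ->
  pullback_norm c u = 0 -> u = 0.
Proof.
move=> xc /enorm_eq0 uc; apply: val_inj; apply/funext => c' /=.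
have [xc'|nxc'] := pselect (charts_at x c').
  by have := tangent_coordE u xc xc'; rewrite uc mul0mx.
by have /asboolP[_ ->] := tangentP u.
Qed.

Lemma form_diag0 g x : tensor g x 0 0 = 0. Proof. by rewrite linear0l. Qed.

Lemma field_norm_ge0 (g : tensor_field M) x (u : tangent x) : 0 <= field_norm g u.
Proof. exact: sqrtr_ge0. Qed.

(** The tensor of a rough metric need not be positive at every point, and
    Num.sqrt is 0 on negative reals.  Where the norm of g is bounded below
    by the norm of a chart, g is positive on nonzero vectors. *)
Lemma metric_locally_pos g x : exists2 A, nbhs x A &
  almost_every A (fun y => forall u : tangent y, 0 <= tensor g y u u).
Proof.
have [c [C [cM cx C1 gC]]] := tensor_comparable g x.
exists (chart_dom c); first exact: (chart_nbhs (atlas_chart cM)).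
apply: almost_every_imply gC => y cy gy u.
have [u0|u0] := eqVneq (pullback_norm c u) 0.
  by rewrite (pullback_norm_eq0 (conj cM cy) u0) form_diag0.
have /andP[lo _] := gy u; apply/ltW; rewrite -sqrtr_gt0.
apply: lt_le_trans lo; rewrite mulr_gt0 ?invr_gt0 ?(lt_le_trans _ C1) //.
by rewrite lt_def u0; exact: enorm_ge0.
Qed.

(** Both metrics are comparable to chart metrics near x, possibly in two
    different charts, and these are comparable by pullback_norm_bound. *)
Lemma metric_locally_le g h x : exists2 A, nbhs x A &
  exists2 C : R, 0 <= C & almost_every A (fun y =>
    forall u : tangent y, field_norm g u <= C * field_norm h u).
Proof.
have [c [C [cM cx C1 gC]]] := tensor_comparable g x.
have [c' [D [c'M c'x D1 hD]]] := tensor_comparable h x.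
have [K K1 cK] := pullback_norm_bound (conj c'M c'x) (conj cM cx).
have C0 : 0 < C by exact: lt_le_trans C1.
have D0 : 0 < D by exact: lt_le_trans D1.
have K0 : 0 < K by exact: lt_le_trans K1.
set B := [set y | forall u : tangent y, pullback_norm c u <= K * pullback_norm c' u].
exists (B `&` (chart_dom c `&` chart_dom c')).
  by apply: filterI => //; apply: filterI;
    [exact: (chart_nbhs (atlas_chart cM))|exact: (chart_nbhs (atlas_chart c'M))].
exists (C * (K * D)); first by rewrite !mulr_ge0 // ltW.
have aG := almost_every_subset (A := B `&` (chart_dom c `&` chart_dom c')) _ gC.
have aH := almost_every_subset (A := B `&` (chart_dom c `&` chart_dom c')) _ hD.
apply: (almost_every_imply _ (almost_everyI (aG _) (aH _))); last 2 first.
- by move=> y [_ []].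
- by move=> y [_ []].
move=> y [By _] [gy hy] u.
have /andP[_ hi] := gy u; have /andP[lo _] := hy u.
apply: le_trans hi _; rewrite -mulrA ler_wpM2l ?(ltW C0) //.
apply: le_trans (By u) _; rewrite -mulrA ler_wpM2l ?(ltW K0) //.
by rewrite -ler_pdivrMl.
Qed.

Section Compact.
Hypothesis cM : compact [set: M].

Lemma metric_pos g : almost_every setT (fun x => forall u : tangent x, 0 <= tensor g x u u).
Proof.
apply: (@compact_induction _ (fun A => almost_every A _)) => //.
- exact: almost_every_set0.
- by move=> A B; exact: almost_every_subset.
- by move=> A B; exact: almost_everyU.
- exact: metric_locally_pos.
Qed.

Lemma metric_le g h : exists2 C : R, 0 <= C & almost_every setT (fun y =>
  forall u : tangent y, field_norm g u <= C * field_norm h u).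
Proof.
apply: (@compact_induction _ (fun A => exists2 C : R, 0 <= C & almost_every A (fun y =>
  forall u : tangent y, field_norm g u <= C * field_norm h u))) => //.
- by exists 0 => //; exact: almost_every_set0.
- by move=> A B AB [C C0 aC]; exists C => //; exact: almost_every_subset aC.
- move=> A B [C C0 aC] [D D0 aD]; exists (C + D); first exact: addr_ge0.
  apply: almost_everyU; [apply: almost_everyS aC|apply: almost_everyS aD] => y gy u;
    by apply: le_trans (gy u) _; rewrite ler_wpM2r ?field_norm_ge0 // ?lerDl ?lerDr.
- exact: metric_locally_le.
Qed.

Definition sum_form g h (s : R) x (u v : tangent x) : R :=
  tensor g x u v + s * tensor h x u v.

Lemma sum_form_bilinear g h s x :
  bilinear_for *%R *%R (@sum_form g h s x).
Proof.
split=> u a v w; rewrite /sum_form.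
  by rewrite !linearPl /= !mulrDr [s * (a * _)]mulrCA addrACA.
by rewrite !linearP /= !mulrDr [s * (a * _)]mulrCA addrACA.
Qed.

HB.instance Definition _ g h s x :=
  bilinear_isBilinear.Build R (tangent x) (tangent x) R *%R *%R
    (@sum_form g h s x) (@sum_form_bilinear g h s x).

Definition sum_tensor g h s : tensor_field M :=
  fun x => @sum_form g h s x : {biscalar (tangent x)}.

Lemma sum_tensorE g h s x (u v : tangent x) :
  sum_tensor g h s x u v = tensor g x u v + s * tensor h x u v.
Proof. by []. Qed.

Lemma sum_tensor_measurable g h s : measurable_field (sum_tensor g h s).
Proof.
move=> c cA; have [G [mG gG]] := tensor_measurable g cA.
have [H [mH hH]] := tensor_measurable h cA.
exists (fun y => G y + s *: H y); split=> [i j|x u v cx].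
  rewrite [X in measurable_fun _ X](_ : _ =
    (fun y => G y i j) \+ (cst s \* (fun y => H y i j))); last first.
    by apply/funext => y; rewrite !mxE.
  by apply: measurable_funD => //; apply: measurable_funM => //; exact: measurable_cst.
rewrite /sum_tensor /= /sum_form gG // hH // mulmxDr mulmxDl [RHS]mxE; congr (_ + _).
by rewrite -scalemxAr -scalemxAl [RHS]mxE.
Qed.

(** The charts that work for g work for g + s h, since h is bounded by a
    multiple of g everywhere. *)
Lemma sum_tensor_comparable g h s : 0 <= s -> forall x, exists c (C : R),
    [/\ atlas c, chart_dom c x, 1 <= C &
        almost_every (chart_dom c) (fun y => forall u : tangent y,
          C^-1 * pullback_norm c u <= field_norm (sum_tensor g h s) u
            <= C * pullback_norm c u)].
Proof.
move=> s0 x; have [c [C [cA cx C1 gC]]] := tensor_comparable g x.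
have [D D0 hD] := metric_le h g.
have C0 : 0 < C by exact: lt_le_trans C1.
(* The factor is that of sqrt_affine_le with t = 0. *)
pose E := C * (1 + `|s - 0| * D ^+ 2).
have sD : 0 <= `|s - 0| * D ^+ 2 by rewrite mulr_ge0 // exprn_ge0.
have CE : C <= E by rewrite /E ler_peMr ?(ltW C0) // lerDl.
exists c, E; split=> //; first exact: le_trans CE.
have sub P := @almost_every_subset _ _ M (chart_dom c) setT P (@subsetT _ _).
apply: almost_everyS (almost_everyI gC (almost_everyI (sub _ hD)
  (almost_everyI (sub _ (metric_pos g)) (sub _ (metric_pos h))))).
move=> y [gy [hy [g0 h0]]] u; have /andP[lo hi] := gy u.
have sh0 : 0 <= s * tensor h y u u by rewrite mulr_ge0.
apply/andP; split.
  apply: (@le_trans _ _ (C^-1 * pullback_norm c u)).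
    by rewrite ler_wpM2r ?enorm_ge0 // lef_pV2 ?posrE // (lt_le_trans C0).
  by apply: le_trans lo _; rewrite /field_norm ler_wsqrtr // sum_tensorE lerDl.
have hDg := ler_sqr_sqrt (h0 u) (g0 u) (hy u).
have := sqrt_affine_le s (g0 u) (h0 u) (lexx 0) hDg.
rewrite mul0r addr0 => H; apply: (le_trans H).
by rewrite /E [C * _]mulrC -mulrA ler_wpM2l ?addr_ge0.
Qed.

Lemma sum_tensor_sym g h s x (u v : tangent x) :
  sum_tensor g h s x u v = sum_tensor g h s x v u.
Proof. by rewrite !sum_tensorE !(tensor_sym _ u). Qed.

Definition sum_metric g h s (s0 : 0 <= s) : roughMetric M :=
  RoughMetric (sum_tensor_sym g h s) (sum_tensor_measurable g h s)
    (sum_tensor_comparable g h s0).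

Lemma sum_metric_close g h : exists2 D : R, 0 <= D &
  forall s t (s0 : 0 <= s) (t0 : 0 <= t),
    close_metrics (1 + `|s - t| * D) (sum_metric g h s0) (sum_metric g h t0).
Proof.
have [D D0 hD] := metric_le h g; exists (D ^+ 2); first exact: sqr_ge0.
move=> s t s0 t0.
apply: almost_everyS (almost_everyI hD (almost_everyI (metric_pos g) (metric_pos h))).
move=> y [hy [g0 h0]] u; have hDg := ler_sqr_sqrt (h0 u) (g0 u) (hy u).
rewrite ler_pdivrMl; last by rewrite ltr_pwDl // mulr_ge0 // sqr_ge0.
rewrite {1}distrC.
by apply/andP; split; exact: sqrt_affine_le.
Qed.

Lemma dist_le_close C g h : 1 <= C -> close_metrics C g h ->
  (rough_dist g h <= (ln C)%:E)%E.
Proof. by move=> C1 gh; apply: ereal_inf_lbound; exists C. Qed.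

(** The absolute value makes the ray total in its parameter. *)
Let ray g h (s : R) : Met M := \pi_(Met M)%qT (sum_metric g h (normr_ge0 s)).

Lemma ray_continuous g h : continuous (ray g h).
Proof.
have [D D0 gh] := sum_metric_close g h.
move=> s; apply/cvg_ballP => e e0.
have D1 : 0 < D + 1 by rewrite ltr_wpDl.
near=> t.
rewrite /ball /= /met_ball /= /ray met_dist_pi.
set w := `| `|s| - `|t| | * D.
have w0 : 0 <= w by rewrite mulr_ge0.
apply: le_lt_trans (dist_le_close _ (gh _ _ _ _)) _; first by rewrite lerDl.
rewrite lte_fin; apply: le_lt_trans (le_ln1Dx _) _; first by rewrite (lt_le_trans _ w0) ?ltrN10.
have st : `|s - t| < e / (D + 1).
  near: t; apply: (@cvgr_dist_lt _ _ _ _ _ id s) => //; rewrite divr_gt0 //.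
apply: (@le_lt_trans _ _ (`|s - t| * (D + 1))); last by rewrite -ltr_pdivlMr.
rewrite ler_pM //; last by rewrite lerDl.
exact: ler_dist_dist.
Unshelve. all: by end_near. Qed.

Lemma ray0 g h : ray g h 0 = \pi_(Met M)%qT g.
Proof.
apply/eqmodP/asboolP; apply: almost_everyT => x u v.
by rewrite /= sum_tensorE normr0 mul0r addr0.
Qed.

Lemma ray1 g h : ray g h 1 = ray h g 1.
Proof.
apply/eqmodP/asboolP; apply: almost_everyT => x u v.
by rewrite /= !sum_tensorE normr1 !mul1r addrC.
Qed.

Lemma compact_connected_Met : connected [set: Met M].
Proof.
have conn_ray g h : connected (range (ray g h)).
  apply: connected_continuous_connected.
    by apply/connected_intervalP => x y _ _ z _.
  by apply: continuous_subspaceT; exact: ray_continuous.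
have [[X _]|X0] := pselect ([set: Met M] !=set0); last first.
  have -> : [set: Met M] = set0 by apply/seteqP; split=> // Y _; case: X0; exists Y.
  exact: connected0.
pose S (Y : Met M) := range (ray (repr X) (repr Y)) `|` range (ray (repr Y) (repr X)).
have -> : [set: Met M] = \bigcup_(Y in setT) S Y.
  apply/seteqP; split=> // Y _; exists Y => //; right; exists 0 => //.
  by rewrite ray0 reprK.
apply: bigcup_connected.
  by exists X => Y _; left; exists 0 => //; rewrite ray0 reprK.
move=> Y _; apply: connectedU; [|exact: conn_ray|exact: conn_ray].
by exists (ray (repr X) (repr Y) 1); split; exists 1 => //; rewrite ray1.
Qed.

End Compact.

End Metrics.

(** * Noncompact manifolds have metrics at infinite distance *)

(** The points at finite distance from x form a set that contains with each
    point the unit ball around it, and so does its complement: it is clopen. *)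
Lemma connected_bounded (R : realType) (T : pseudoMetricType R) :
  connected [set: T] -> forall x y : T, exists r : R, ball x r y.
Proof.
move=> cT x y; pose B : set T := [set z | exists r : R, ball x r z].
suff BT : B = setT by have : B y by rewrite BT.
apply: cT.
- by exists x; exists 1; exact: ballxx.
- exists B; last by rewrite setTI.
  rewrite openE => z [r xz]; apply/nbhs_ballP; exists 1 => //= t zt.
  by exists (r + 1); exact: ball_triangle xz zt.
- exists B; last by rewrite setTI.
  rewrite -[B]setCK; apply: open_closedC; rewrite openE => z nz.
  apply/nbhs_ballP; exists 1 => //= t zt [r xt]; apply: nz.
  by exists (r + 1); apply: ball_triangle xt _; exact: ball_sym.
Qed.

(** The Lindelof property: to each basic open set contained in the interior of
    some V x, attach one such x. *)
Lemma second_countable_nbhs_cover (T : topologicalType) (V : T -> set T) (x0 : T) :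
  @second_countable T -> (forall x, nbhs x (V x)) ->
  exists s : nat -> T, forall y, exists i, (V (s i))° y.
Proof.
move=> [B /countable_injP[f fI] [Bo BB]] xV.
pose Q (k : nat) (x : T) := exists U, [/\ B U, f U = k & U `<=` (V x)°].
have /choice[s sP] : forall k, exists x, (exists z, Q k z) -> Q k x.
  move=> k; have [[z Qz]|nQ] := pselect (exists z, Q k z); first by exists z.
  by exists x0 => /nQ.
exists s => y; have : nbhs y (V y)° by apply: nbhs_interior.
move=> /(BB y)[U [BU Uy] UV]; exists (f U).
have [|U' [BU' fU' UV']] := sP (f U); first by exists y, U.
by apply: UV'; rewrite (fI U' U) //; exact: mem_set.
Qed.

Lemma open_continuous_measurable (R : realType) (n : nat) (D : set 'rV[R]_n)
    (f : 'rV[R]_n -> R) : open D -> (forall x, D x -> {for x, continuous f}) ->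
  measurable_fun (D : set (lebesgue_space R n)) (f : lebesgue_space R n -> R).
Proof.
move=> oD cf; apply: (measurability _ (RGenOpens.measurableE R)).
move=> _ [_ [a [b ->] <-]]; apply: sub_sigma_algebra; left.
have : forall x : 'rV[R]_n, D x /\ `]a, b[%classic (f x) ->
    nbhs x (D `&` f @^-1` `]a, b[%classic).
  move=> x [Dx fx]; apply: filterI; first exact: open_nbhs_nbhs.
  apply: (cf x Dx); apply: open_nbhs_nbhs; split => //.
have opn : forall A : set 'rV[R]_n, (forall x, A x -> nbhs x A) -> open A.
  by move=> A; rewrite openE.
exact: opn.
Qed.

Section Exhaustion.
Variables (R : realType) (n : nat) (M : smoothManifold R n).
Implicit Types (x : M).

Lemma manifold_compact_cover (x0 : M) : exists (c : nat -> chart R n M) (K : nat -> set M),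
  [/\ forall i, atlas (c i), forall i, compact (K i),
      forall i, K i `<=` chart_dom (c i) & forall x, exists i, (K i)° x].
Proof.
have /choice[F FP] : forall x, exists p : chart R n M * set M,
    [/\ atlas p.1, compact p.2, p.2 `<=` chart_dom p.1 & nbhs x p.2].
  move=> x; have [c cM cx] := atlas_cover x.
  by have [K [cK Kc xK]] := compact_chart_nbhs (atlas_chart cM) cx; exists (c, K).
have [|s sP] := @second_countable_nbhs_cover M (fun x => (F x).2) x0 (@manifold_second_countable _ _ M).
  by move=> x; have [] := FP x.
exists (fun i => (F (s i)).1), (fun i => (F (s i)).2).
by split=> // i; have [] := FP (s i).
Qed.

(** A chart with values in R^0 is injective, so points are open as well as
    closed. *)
Lemma dim0_compact : n = 0%N -> connected [set: M] -> compact [set: M].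
Proof.
move=> n0 conn; have [[x _]|M0] := pselect ([set: M] !=set0); last first.
  have -> : [set: M] = set0 by apply/seteqP; split=> // Y _; case: M0; exists Y.
  exact: compact0.
have <- : [set x] = [set: M]; last exact: compact_set1.
apply: conn; first by exists x.
  exists [set x]; last by rewrite setTI.
  have [c cM cx] := atlas_cover x.
  have <- : chart_dom c = [set x]; last exact: chart_dom_open (atlas_chart cM).
  apply/seteqP; split=> [y cy /=|_ -> //].
  rewrite -(chart_mapK (atlas_chart cM) cx) -(chart_mapK (atlas_chart cM) cy).
  by congr chart_inv; apply/rowP => -[i i_n]; have := i_n; rewrite {1}n0.
exists [set x]; last by rewrite setTI.
apply: compact_closed; first exact: manifold_hausdorff.
exact: compact_set1.
Qed.

End Exhaustion.

Section Piecewise.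
Variables (R : realType) (n : nat) (M : smoothManifold R n).
Implicit Types (x : M).
Variables (c : nat -> chart R n M) (K : nat -> set M).
Hypotheses (cA : forall i, atlas (c i)) (cK : forall i, compact (K i)).
Hypotheses (Kc : forall i, K i `<=` chart_dom (c i)) (Kcov : forall x, exists i, (K i)° x).

Lemma ex_piece x : exists i, `[< (K i)° x >].
Proof. by have [i xi] := Kcov x; exists i; apply/asboolP. Qed.

(** Taking the least index splits M into countably many measurable pieces, of
    which only those of index at most i meet the interior of K i. *)
Definition piece (x : M) : nat := ex_minn (ex_piece x).

Lemma pieceP x : (K (piece x))° x.
Proof. by rewrite /piece; case: ex_minnP => i /asboolP. Qed.

Lemma piece_le x j : (K j)° x -> (piece x <= j)%N.
Proof. by rewrite /piece; case: ex_minnP => i _ H xj; apply: H; apply/asboolP. Qed.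

Lemma charts_at_piece x : charts_at x (c (piece x)).
Proof.
split; first exact: cA.
exact: (Kc (interior_subset (pieceP x))).
Qed.

Lemma tangent_coordP (c' : chart R n M) x a (u v : tangent x) :
  tangent_coord c' (a *: u + v) = a *: tangent_coord c' u + tangent_coord c' v.
Proof.
have := linearP (GRing.Linear.clone _ _ _ _ (\val : tangent x -> _) _) a u v.
by rewrite /tangent_coord /= => ->.
Qed.

Variable W : nat -> R.
Hypothesis W0 : forall i, 0 < W i.

(** The weight is squared so that norms are multiplied by W. *)
Definition piece_form x (u v : tangent x) : R :=
  W (piece x) ^+ 2 *
  (tangent_coord (c (piece x)) u *m (tangent_coord (c (piece x)) v)^T) 0 0.

Lemma piece_form_bilinear x : bilinear_for *%R *%R (@piece_form x).
Proof.
split=> u a v w; rewrite /piece_form tangent_coordP.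
  by rewrite mulmxDl -scalemxAl !mxE mulrDr mulrCA.
by rewrite linearD linearZ /= mulmxDr -scalemxAr !mxE mulrDr mulrCA.
Qed.

HB.instance Definition _ x :=
  bilinear_isBilinear.Build R (tangent x) (tangent x) R *%R *%R
    (@piece_form x) (@piece_form_bilinear x).

Definition piece_tensor : tensor_field M :=
  fun x => @piece_form x : {biscalar (tangent x)}.

Lemma piece_tensorE x (u v : tangent x) : piece_tensor x u v =
  W (piece x) ^+ 2 *
  (tangent_coord (c (piece x)) u *m (tangent_coord (c (piece x)) v)^T) 0 0.
Proof. by []. Qed.

Lemma piece_tensor_sym x (u v : tangent x) : piece_tensor x u v = piece_tensor x v u.
Proof.
rewrite !piece_tensorE; congr (_ * _).
by rewrite -[in LHS](trmxK (tangent_coord _ u)) -trmx_mul mxE.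
Qed.

Lemma piece_norm x (u : tangent x) :
  field_norm piece_tensor u = W (piece x) * pullback_norm (c (piece x)) u.
Proof.
rewrite /field_norm piece_tensorE -sqr_enorm -exprMn sqrtr_sqr ger0_norm //.
by rewrite mulr_ge0 ?enorm_ge0 // ltW.
Qed.

(** In a chart, the image of each piece is a difference of open sets, and on it
    the coefficients are those of J J^T for the Jacobian J of a transition
    map, which are continuous. *)
Lemma piece_measurable : measurable_field piece_tensor.
Proof.
move=> c' c'A; have c'P := atlas_chart c'A.
pose J k y := jacobian (transition c' (c k)) y.
pose G k y : 'M[R]_n := W k ^+ 2 *: (J k y *m (J k y)^T).
pose p y := piece (chart_inv c' y).
exists (fun y => G (p y) y); split=> [i j|x u v c'x]; last first.
  have xc' : charts_at x c' by split.
  rewrite piece_tensorE /p chart_mapK // /G -scalemxAr -scalemxAl [RHS]mxE.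
  congr (_ * _); rewrite !(tangent_coordE _ xc' (charts_at_piece x)).
  by rewrite trmx_mul !mulmxA.
pose O k := c' @` ((K k)° `&` chart_dom c').
have oO k : open (O k) by apply: open_image_chart => //; exact: open_interior.
pose D k : set (lebesgue_space R n) := O k `\` \bigcup_(j in `I_k) O j.
have Dp k y : D k y -> chart_img c' y /\ p y = k.
  move=> [[x [Kx cx] <-] nO]; split; first by exists x.
  rewrite /p chart_mapK //; apply/eqP; rewrite eqn_leq piece_le //= leqNgt.
  apply/negP => xk; apply: nO; exists (piece x) => //; exists x => //; split=> //.
  exact: pieceP.
have mo (A : set 'rV[R]_n) : open A -> measurable (A : set (lebesgue_space R n)).
  by move=> oA; apply: sub_sigma_algebra; left.
have mD k : measurable (D k).
  by apply: measurableD; apply: mo => //; apply: bigcup_open => l _.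
have -> : chart_img c' = \bigcup_k D k.
  apply/seteqP; split=> [_ [x c'x <-]|y [k _ /Dp[]//]].
  exists (piece x) => //; split; first by exists x => //; split=> //; exact: pieceP.
  move=> [l /= lx [z [Kz cz] zx]].
  have zx' : z = x by rewrite -(chart_mapK c'P cz) zx chart_mapK.
  by rewrite zx' in Kz; have := piece_le Kz; rewrite leqNgt lx.
apply/measurable_fun_bigcup => // k.
apply: (eq_measurable_fun ((fun y => G k y i j) : lebesgue_space R n -> R)).
  by move=> y /set_mem/Dp[_ ->].
pose E := c' @` (chart_dom (c k) `&` chart_dom c').
have oE : open E by apply: open_image_chart => //; exact: chart_dom_open (atlas_chart (cA k)).
apply: (@measurable_funS _ _ (lebesgue_space R n) _ E); first exact: mo.
  by move=> _ [[x [/interior_subset/Kc Kx cx] <-] _]; exists x.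
apply: open_continuous_measurable => // _ [x [ckx c'x] <-].
have -> : (fun y => G k y i j) =
    (fun y : 'rV[R]_n => W k ^+ 2 * \sum_l (J k y i l * J k y j l)).
  apply/funext => y; rewrite /G [LHS]mxE [X in _ * X = _]mxE.
  by congr (_ * _); apply: eq_bigr => l _; congr (_ * _); exact: mxE.
apply: continuousM; first exact: cst_continuous.
by apply: continuous_at_sum => l; apply: continuousM; exact: jacobian_continuous.
Qed.

(** The transition map from c' to its restriction is the one from c' to itself,
    whose Jacobian is the identity. *)
Lemma pullback_norm_restrict (c' : chart R n M) (U : set M) x (u : tangent x) : atlas c' -> open U ->
  U x -> chart_dom c' x -> pullback_norm (restrict_chart c' U) u = pullback_norm c' u.
Proof.
move=> c'A oU Ux cx; have xc : charts_at x c' by split.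
have xr : charts_at x (restrict_chart c' U).
  by split; [exact: restrict_chart_atlas|split].
rewrite /pullback_norm (tangent_coordE u xc xr).
have -> : transition c' (restrict_chart c' U) = transition c' c' by [].
by rewrite jacobian_transition_id // mulmx1.
Qed.

(** Either x lies in the domain of c j and pullback_norm_bound applies, or x
    lies outside K j, which is closed as M is Hausdorff, and then K j stays
    away from x. *)
Lemma piece_norm_bound x (c' : chart R n M) j : charts_at x c' ->
  exists2 C : R, 1 <= C & \forall y \near x, K j y -> forall u : tangent y,
    pullback_norm c' u <= C * (W j * pullback_norm (c j) u) /\
    W j * pullback_norm (c j) u <= C * pullback_norm c' u.
Proof.
move=> xc'; have [cjx|ncjx] := pselect (chart_dom (c j) x); last first.
  exists 1 => //; have : closed (K j).
    by apply: compact_closed => //; exact: manifold_hausdorff.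
  move=> /closed_openC oK; have nKx : (~` K j) x by move=> /Kc.
  by apply: filterS (open_nbhs_nbhs (conj oK nKx)) => y.
have xcj : charts_at x (c j) by split.
have [A A1 cA1] := pullback_norm_bound xc' xcj.
have [B B1 cB1] := pullback_norm_bound xcj xc'.
have A0 : 0 < A by exact: lt_le_trans A1.
have B0 : 0 < B by exact: lt_le_trans B1.
have Wi0 : 0 <= (W j)^-1 by rewrite invr_ge0 ltW.
have WA : 0 <= W j * A by rewrite mulr_ge0 ?ltW.
have WB : 0 <= B / W j by rewrite divr_ge0 // ltW.
exists (1 + W j * A + B / W j); first by rewrite -addrA lerDl addr_ge0.
apply: filterS2 cA1 cB1 => y yA yB _ u; split.
  apply: le_trans (yB u) _.
  rewrite -[B in leLHS](divfK (lt0r_neq0 (W0 j))) -[_ * W j * _]mulrA.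
  apply: ler_wpM2r; first by rewrite mulr_ge0 ?enorm_ge0 // ltW.
  by rewrite lerDr addr_ge0.
apply: le_trans (_ : W j * A * pullback_norm c' u <= _).
  by rewrite -mulrA ler_wpM2l // ltW.
apply: ler_wpM2r; first exact: enorm_ge0.
by rewrite addrAC lerDr addr_ge0.
Qed.

(** Near x only the pieces of index at most that of x occur, so that finitely
    many of the constants of piece_norm_bound are involved. *)
Lemma piece_comparable x : exists c (C : R),
    [/\ atlas c, chart_dom c x, 1 <= C &
        almost_every (chart_dom c) (fun y => forall u : tangent y,
          C^-1 * pullback_norm c u <= field_norm piece_tensor u
            <= C * pullback_norm c u)].
Proof.
set i0 := piece x; have xc := charts_at_piece x.
have /choice[C CP] : forall j, exists C : R, 1 <= C /\
   \forall y \near x, K j y -> forall u : tangent y,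
    pullback_norm (c i0) u <= C * (W j * pullback_norm (c j) u) /\
    W j * pullback_norm (c j) u <= C * pullback_norm (c i0) u.
  by move=> j; have [C C1 H] := piece_norm_bound j xc; exists C.
pose C1 := 1 + \sum_(j < i0.+1) C j.
have C0 j : 0 <= C j by have [C1' _] := CP j; exact: le_trans C1'.
have s0 : 0 <= \sum_(j < i0.+1) C j by apply: sumr_ge0 => j _; exact: C0.
have C1gt : 0 < C1 by rewrite ltr_pwDl.
have CC1 j : (j <= i0)%N -> C j <= C1.
  rewrite -ltnS => ji; rewrite /C1 (bigD1 (Ordinal ji)) //= addrCA lerDl addr_ge0 //.
  by apply: sumr_ge0 => l _; exact: C0.
pose U := [set y | forall j : 'I_i0.+1, K j y -> forall u : tangent y,
    pullback_norm (c i0) u <= C j * (W j * pullback_norm (c j) u) /\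
    W j * pullback_norm (c j) u <= C j * pullback_norm (c i0) u].
have xU : nbhs x U by apply: filter_forall => j; exact: (CP j).2.
pose V := U° `&` (K i0)°.
have oV : open V by apply: openI; exact: open_interior.
have Vx : V x by split=> //; exact: pieceP.
exists (restrict_chart (c i0) V), C1; split.
- exact: restrict_chart_atlas.
- by split=> //; exact: xc.2.
- by rewrite lerDl.
apply: (@almost_every_imply _ _ _ _ (fun=> True)); last exact: almost_everyT.
move=> y [Vy cy] _ u; rewrite pullback_norm_restrict // piece_norm.
have yi : (piece y <= i0)%N by apply: piece_le; case: Vy.
have [] := interior_subset Vy.1 (Ordinal (yi : (piece y < i0.+1)%N)) _ u.
  exact: (interior_subset (pieceP y)).
move=> /= lo hi; rewrite ler_pdivrMl //; apply/andP; split.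
  apply: le_trans lo _; rewrite ler_wpM2r ?CC1 //.
  by rewrite mulr_ge0 ?enorm_ge0 // ltW.
by apply: le_trans hi _; rewrite ler_wpM2r ?CC1 ?enorm_ge0.
Qed.

Definition piece_metric : roughMetric M :=
  RoughMetric piece_tensor_sym piece_measurable piece_comparable.

End Piecewise.

Section NonCompact.
Variables (R : realType) (n : nat) (M : smoothManifold R n).

(** With weights 1 and i + 1, comparability with constant C forces i + 1 <= C
    almost everywhere on the i-th piece.  Outside the first N of the K i, for
    N > C, this fails at every point, so that this open set is null, hence
    empty, and M is a finite union of compact sets. *)
Lemma connected_Met_compact : connected [set: M] -> connected [set: Met M] ->
  compact [set: M].
Proof.
move=> connM connMet; have [n0|n0] := posnP n; first exact: dim0_compact.
apply: contrapT => ncM.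
have [[x0 _]|M0] := pselect ([set: M] !=set0); last first.
  apply: ncM; have -> : [set: M] = set0 by apply/seteqP; split=> // Y _; case: M0; exists Y.
  exact: compact0.
have [c [K [cA cK Kc Kcov]]] := manifold_compact_cover x0.
pose W1 (i : nat) : R := 1; pose W2 (i : nat) : R := i.+1%:R.
have W10 i : 0 < W1 i by [].
have W20 i : 0 < W2 i by rewrite ltr0n.
pose g := piece_metric cA cK Kc Kcov W10.
pose h := piece_metric cA cK Kc Kcov W20.
have [r] := connected_bounded connMet (\pi_(Met M)%qT g) (\pi_(Met M)%qT h).
rewrite /ball /= /met_ball /= met_dist_pi => /ereal_inf_lt[_ [C [C1 gh] _] _].
pose N := (Num.truncn C).+1.
have CN : C < N%:R by exact: truncnS_gt.
pose A := \big[setU/set0]_(j < N) K j.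
have cptA : compact A by apply: bigsetU_compact.
have oA : open (~` A) by apply: closed_openC; apply: compact_closed => //; exact: manifold_hausdorff.
have A0 : ~` A = set0.
  apply: open_measure_zero => // c' c'A; apply: lebesgue_nullS (gh c' c'A).
  apply: image_subset => y [Ay c'y]; split=> //; split=> // ghy.
  have Np : (N <= piece Kcov y)%N.
    rewrite leqNgt; apply/negP => pN; apply: Ay.
    rewrite /A -bigcup_mkord; exists (piece Kcov y) => //.
    exact: (interior_subset (pieceP Kcov y)).
  have [u uE] := tangent_coord_surj (const_mx 1) (charts_at_piece cA Kc Kcov y).
  have /andP[+ _] := ghy u; rewrite !piece_norm // /W1 /W2 mul1r.
  have u0 : 0 < pullback_norm (c (piece Kcov y)) u.
    rewrite lt_def enorm_ge0 andbT; apply/eqP => /enorm_eq0.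
    rewrite uE => /rowP/(_ (Ordinal n0))/eqP; rewrite !mxE oner_eq0 //.
  have C0 : 0 < C by exact: lt_le_trans C1.
  rewrite ler_pdivrMl // ler_pM2r //; apply/negP; rewrite -ltNge.
  by apply: lt_le_trans CN _; rewrite ler_nat ltnW.
by apply: ncM; rewrite -(setCK [set: M]) setCT -A0 setCK.
Qed.

End NonCompact.

Theorem theorem2p7 (R : realType) (n : nat) (M : smoothManifold R n)
    (connected_M : connected [set: M]) :
  compact [set: M] <-> connected [set: Met M].
Proof.
split; first exact: compact_connected_Met.
exact: connected_Met_compact.
Qed.
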